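(* Let $1 \le k \le n$ be integers and let $\mathbb{H} \subset \mathbb{C}$ be a closed half-plane. Let $f \in \mathbb{C}[X_1,\dots,X_n]$ be a symmetric polynomial that can be written as a polynomial in $k$ symmetric and multiaffine polynomials of $\mathbb{C}[X_1,\dots,X_n]$. Let $x \in \mathbb{H}^n$. Then there exists a point $\tilde{x} \in \mathbb{H}_{2(k+2),\,k+2}$ with $f(x) = f(\tilde{x})$.
   Context: A polynomial is multiaffine if it has degree at most one in each variable. For a closed half-plane $\mathbb{H} \subset \mathbb{C}$ with boundary line $\operatorname{bd}\mathbb{H}$ and interior $\operatorname{int}\mathbb{H}$, and nonnegative integers $p,q$, define $$\mathbb{H}_{p,q} := \left\{ x \in \mathbb{H}^n : |\{x_1,\dots,x_n\} \cap \operatorname{bd}\mathbb{H}| \le p \text{ and } |\{ j \in \{1,\dots,n\} : x_j \in \operatorname{int}\mathbb{H} \}| \le q \right\},$$ i.e. points with at most $p$ distinct coordinate values on the boundary and at most $q$ coordinates (counted with repetition) in the interior. *)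

(* Defs.v *)
From HB Require Import structures.
From mathcomp Require Import all_boot all_order all_algebra.
From mathcomp Require Import complex mpoly.

Set Implicit Arguments.
Unset Strict Implicit.
Unset Printing Implicit Defensive.

Import Order.TTheory GRing.Theory Num.Theory.
Local Open Scope ring_scope.

(* The closed half-plane {z | 0 <= Re (a z) + b}, with a <> 0: every closed
   half-plane of the complex plane has this form, and (a, b) is determined by
   it up to a positive real factor. *)
Record half_plane (R : rcfType) := HalfPlane {
  hp_normal : R[i];
  hp_offset : R;
  hp_normal_neq0 : hp_normal != 0
}.

Section HalfPlane.
Variables (R : rcfType) (H : half_plane R).

Definition hp_form (z : R[i]) : R :=
  complex.Re (hp_normal H * z) + hp_offset H.

Definition hp : {pred R[i]} := fun z => 0 <= hp_form z.
Definition hp_bd : {pred R[i]} := fun z => hp_form z == 0.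
Definition hp_int : {pred R[i]} := fun z => 0 < hp_form z.

(* hp_int is the topological interior of hp. *)
Lemma hp_intP (z : R[i]) :
  z \in hp_int <->
  exists2 e : R[i], 0 < e & forall w, `|w - z| < e -> w \in hp.
Proof.
have a0 : 0 < `|hp_normal H| by rewrite normr_gt0 hp_normal_neq0.
have formB w : hp_form w = hp_form z + complex.Re (hp_normal H * (w - z)).
  rewrite /hp_form mulrBr raddfB /= addrAC; congr (_ + _).
  by rewrite addrC subrK.
have ReC (x : R) : complex.Re x%:C%C = x by [].
rewrite !unfold_in; split=> [z0|[e e0 hpe]].
  exists ((hp_form z)%:C%C / `|hp_normal H|).
    by rewrite divr_gt0 // ltcR.
  move=> w; rewrite ltr_pdivlMr // mulrC -normrM => lt_w.
  have := le_lt_trans (normc_ge_Re (hp_normal H * (w - z))) lt_w.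
  rewrite ltcR => {}lt_w.
  rewrite unfold_in formB; move: lt_w; rewrite ltr_norml => /andP[+ _].
  by rewrite ltrNl -subr_gt0 opprK => /ltW.
pose x := e * `|hp_normal H| / 2%:R.
have x0 : 0 < x by rewrite divr_gt0 ?mulr_gt0 ?ltr0n.
have /hpe : `|z - x / hp_normal H - z| < e.
  rewrite addrC addKr normrN normrM normfV gtr0_norm // ltr_pdivrMr //.
  by rewrite ltr_pdivrMr ?ltr0n // ltr_pMr ?mulr_gt0 // ltr1n.
rewrite unfold_in formB [_ - _ - z]addrC addKr mulrN mulrCA divff;
  last exact: hp_normal_neq0.
rewrite mulr1 raddfN subr_ge0; apply: lt_le_trans.
by move: x0; rewrite ltcE => /andP[].
Qed.

End HalfPlane.

(* The set H_{p,q} of points of C^n. *)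
Definition hp_pq (R : rcfType) (H : half_plane R) (n p q : nat) :
    {pred 'I_n -> R[i]} :=
  fun x => [&& [forall j, x j \in hp H],
    (size (undup [seq z <- codom x | z \in hp_bd H]) <= p)%N &
    (#|[set j | x j \in hp_int H]| <= q)%N].

Definition multiaffine (R : nzRingType) (n : nat) (p : {mpoly R[n]}) : Prop :=
  forall m : 'X_{1..n}, m \in msupp p -> forall i : 'I_n, (m i <= 1)%N.

(* Main.v *)
(* After an affine change of variables the half-plane is the upper one. A
   symmetric multiaffine polynomial is a linear combination of elementary
   symmetric polynomials, so its value at y is a linear functional of the
   coefficients of F_y = prod_j (X - y_j). Hence it suffices to keep k + 2
   linear functionals of F_y fixed: the k given ones and the two top nonleading
   coefficients. Fixing the latter makes the set of admissible y compact: the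
   sum of the y_j bounds the imaginary parts and the sum of the y_j^2 then
   bounds the real parts. Choose y in this set maximising the squared norm of
   the coefficients of F_y. By strict convexity F_y is not the midpoint of two
   distinct polynomials of the set. If more than k + 2 roots were interior, one
   could perturb the factor carrying them by a complex polynomial of smaller
   degree; if there were more than 2(k + 2) distinct real roots, one could
   perturb the product of the corresponding distinct linear factors by a real
   polynomial of smaller degree, keeping it real-rooted. Counting dimensions,
   some nonzero perturbation leaves all the functionals unchanged. *)

From HB Require Import structures.
Require Import Defs.
From mathcomp Require Import all_boot all_order all_algebra.
From mathcomp Require Import complex mpoly reals.
From mathcomp Require Import perm polyrcf ring lra.
From mathcomp Require Import classical_sets topology normedtype derive.

Set Implicit Arguments.
Unset Strict Implicit.
Unset Printing Implicit Defensive.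

Import Order.TTheory GRing.Theory Num.Theory.
Import numFieldNormedType.Exports.
Local Open Scope ring_scope.

(** * Polynomials with given roots *)

Definition root_poly (K : nzRingType) n (y : 'I_n -> K) : {poly K} :=
  \prod_(j < n) ('X - (y j)%:P).

Lemma size_root_poly (K : idomainType) n (y : 'I_n -> K) :
  size (root_poly y) = n.+1.
Proof. by rewrite size_prod_XsubC /= /index_enum -enumT size_enum_ord. Qed.

Lemma root_poly_monic (K : idomainType) n (y : 'I_n -> K) :
  root_poly y \is monic.
Proof. by apply: monic_prod => j _; exact: monicXsubC. Qed.

Lemma monic_addr_lt (K : nzRingType) (p q : {poly K}) :
  p \is monic -> (size q < size p)%N -> p + q \is monic.
Proof. by move=> mp sq; rewrite monicE lead_coefDl. Qed.

Lemma root_polyP (K : idomainType) n (y : 'I_n -> K) z :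
  root (root_poly y) z = [exists j, z == y j].
Proof.
rewrite rootE horner_prod; apply/eqP/existsP.
  move=> /eqP/prodf_eq0[j _]; rewrite hornerXsubC subr_eq0 => zj.
  by exists j.
by case=> j /eqP->; rewrite (bigD1 j) //= hornerXsubC subrr mul0r.
Qed.

Lemma closed_field_root_poly (K : closedFieldType) n (p : {poly K}) :
  p \is monic -> size p = n.+1 -> exists y : 'I_n -> K, p = root_poly y.
Proof.
move=> /monicP mp sp; have [s] := closed_field_poly_normal p.
rewrite mp scale1r => pE; have ss : size s = n.
  by move: sp; rewrite pE size_prod_XsubC => -[].
exists (fun j => s`_j); rewrite pE /root_poly -ss.
by rewrite (big_nth 0) big_mkord.
Qed.

(* Multiplying by X and X^2 shifts the coefficients so that the formulas hold
   also for fewer than two roots. *)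
Lemma coef_prod_XsubC_top (K : comNzRingType) (s : seq K)
    (p := \prod_(z <- s) ('X - z%:P)) :
  [/\ p`_(size s) = 1, ('X * p)`_(size s) = - \sum_(z <- s) z &
      ('X ^+ 2 * p)`_(size s) *+ 2
        = (\sum_(z <- s) z) ^+ 2 - \sum_(z <- s) z ^+ 2].
Proof.
rewrite {}/p; elim: s => [|z s [IH0 IH1 IH2]].
  rewrite !big_nil !mulr1 coefX coefXn coefC /= expr2 mulr0 subrr oppr0.
  by rewrite mul0rn.
rewrite !big_cons /=; set q := \prod_(_ <- s) _ in IH0 IH1 IH2 *.
have top : q`_(size s).+1 = 0 by rewrite nth_default // size_prod_XsubC.
split; first by rewrite mulrBl coefB coefXM coefCM top /= IH0 mulr0 subr0.
  rewrite coefXM /= mulrBl coefB coefCM IH0 IH1 mulr1; ring.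
have -> : 'X ^+ 2 * (('X - z%:P) * q) = 'X * ('X ^+ 2 * q - z%:P * ('X * q)).
  ring.
rewrite coefXM /= coefB coefCM IH1 mulrnBl IH2; ring.
Qed.

(** * Perturbation of polynomials *)

(** Dimension count: the images of the monomials ['X^i] with [i < a] are the rows of a matrix with
    only [b < a] columns, so some nonzero combination of them vanishes. *)
Lemma poly_kernel (K : fieldType) a b (f : {poly K} -> 'rV[K]_b) :
  linear f -> (b < a)%N ->
  exists2 q : {poly K}, q != 0 & (size q <= a)%N /\ f q = 0.
Proof.
move=> lf ba; pose A := \matrix_(i < a) f 'X^i.
have /rowV0Pn[u /sub_kermxP uA u0] : kermx A != 0.
  rewrite -mxrank_eq0 mxrank_ker subn_eq0 -ltnNge.
  by rewrite (leq_ltn_trans (rank_leq_col _)).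
exists (rVpoly u); first by apply: contraNneq u0 => u0;
  rewrite -[u]rVpolyK u0 linear0.
split; first exact: size_poly.
have f0 : f 0 = 0 by have := lf (-1) 0 0; rewrite scaleN1r oppr0 addr0 scaleN1r addNr.
rewrite -uA mulmx_sum_row; have -> : rVpoly u = \sum_i u 0 i *: 'X^i.
  by rewrite /rVpoly poly_def; apply: eq_bigr => i _; rewrite valK.
elim/big_rec2: _ => // i _ p _ <-.
by rewrite lf rowK.
Qed.

(** Each factor is at least its own [d] in modulus on [S], so [B] is the product of the inverses
    [d^-1]. *)
Lemma prod_XsubC_away (K : numFieldType) (s : seq K) (S : K -> Prop) :
  (forall w, w \in s -> exists2 d, 0 < d & forall z, S z -> d <= `|z - w|) ->
  exists2 B, 0 < B & forall z, S z ->
    1 <= B * `|(\prod_(w <- s) ('X - w%:P)).[z]|.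
Proof.
elim: s => [|w s IH] far.
  by exists 1 => // z _; rewrite big_nil hornerC normr1 mulr1.
have [v vs|B B0 low] := IH; first by apply: far; rewrite inE vs orbT.
have [d d0 dw] := far w (mem_head _ _).
exists (d^-1 * B) => [|z Sz]; first by rewrite mulr_gt0 ?invr_gt0.
rewrite big_cons hornerM hornerXsubC normrM mulrACA -[leLHS]mulr1.
apply: ler_pM => //; last exact: low.
by rewrite ler_pdivlMl // mulr1 dw.
Qed.

(** Induction by Euclidean division: in [q = q1 * ('X - w) + q.[w]], the quotient is dominated by
    the remaining factors, and the constant by [prod_XsubC_away]. *)
Lemma prod_XsubC_dominates (K : numFieldType) (s : seq K) (S : K -> Prop)
    (q : {poly K}) :
  (forall w, w \in s -> exists2 d, 0 < d & forall z, S z -> d <= `|z - w|) ->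
  (size q <= size s)%N ->
  exists2 B, 0 < B & forall z, S z ->
    `|q.[z]| <= B * `|(\prod_(w <- s) ('X - w%:P)).[z]|.
Proof.
elim: s q => [|w s IH] q far sq.
  exists 1 => // z _; move: sq; rewrite leqn0 size_poly_eq0 => /eqP->.
  by rewrite big_nil !hornerC normr0 normr1 mulr1.
have [B0 B00 low] := prod_XsubC_away far.
have [v vs||B1 B10 dom] := IH (q %/ ('X - w%:P)).
- by apply: far; rewrite inE vs orbT.
- by rewrite size_divp ?polyXsubC_eq0 // size_XsubC leq_subLR add1n.
exists (B1 + `|q.[w]| * B0) => [|z Sz].
  by rewrite ltr_wpDr ?mulr_ge0 // ltW.
rewrite {1}(divp_eq q ('X - w%:P)) modp_XsubC hornerD hornerC hornerM.
apply: (le_trans (ler_normD _ _)); rewrite mulrDl lerD //.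
  rewrite big_cons hornerM !normrM [leRHS]mulrCA mulrC ler_wpM2l //.
  exact: dom.
by rewrite -mulrA -[leLHS]mulr1 ler_wpM2l // low.
Qed.

(** Nonpositive entries are skipped, so lists such as all pairwise distances can be used without
    removing their zeros. *)
Lemma finite_lower_bound (F : realFieldType) (s : seq F) :
  exists2 d, 0 < d & forall e, e \in s -> 0 < e -> d < e.
Proof.
elim: s => [|a s [d d0 ds]]; first by exists 1.
have [a0|a0] := ltrP 0 a; last first.
  by exists d => // e; rewrite inE => /predU1P[->|/ds //]; rewrite ltNge a0.
exists (Num.min d (a / 2)) => [|e]; first by rewrite lt_min d0 divr_gt0.
rewrite inE gt_min => /predU1P[-> _|es e0]; last by rewrite ds.
by apply/orP; right; lra.
Qed.

Lemma perturbed_sign (F : realFieldType) (u v a b : F) :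
  `|a| < `|u| -> `|b| < `|v| -> u * v < 0 -> (u + a) * (v + b) < 0.
Proof.
wlog u0 : u v a b / 0 < u => [th|].
  move=> au bv uv; have [u0|u0|u0] := ltrgt0P u; first exact: th.
    rewrite -mulrNN !opprD; apply: th; rewrite ?normrN ?oppr_gt0 //.
    by rewrite mulrNN.
  by move: uv; rewrite u0 mul0r ltxx.
move=> au bv uv; have v0 : v < 0 by rewrite -(pmulr_rlt0 _ u0).
move: au bv; rewrite (gtr0_norm u0) (ltr0_norm v0) !ltr_norml.
move=> /andP[a1 a2] /andP[b1 b2].
by rewrite pmulr_rlt0; lra.
Qed.

(** Only the factor of [a] changes sign between [a - d] and [a + d]; every other root lies farther
    than [d] from [a]. *)
Lemma prod_XsubC_sign_change (F : realFieldType) (r : seq F) (a d : F) :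
  uniq r -> a \in r -> 0 < d ->
  (forall b, b \in r -> b != a -> d < `|a - b|) ->
  let p := \prod_(b <- r) ('X - b%:P) in p.[a - d] * p.[a + d] < 0.
Proof.
move=> ur ar d0 sep /=; rewrite (big_rem a ar) /= !hornerM !hornerXsubC.
rewrite mulrACA pmulr_llt0; first by nra.
rewrite !horner_prod -big_split /= big_seq; apply: prodr_gt0 => b.
rewrite mem_rem_uniq // inE => /andP[ba br].
have := sep b br ba; rewrite !hornerXsubC.
have [ab dab|ab dab|_] := ltrgt0P (a - b); first by nra.
  by nra.
by rewrite ltNge ltW.
Qed.

(** Around each simple root the sign change survives a small perturbation, so the intermediate value
    theorem yields a root nearby. These [size r] distinct roots exhaust the degree, which [q] does
    not raise. *)
Lemma real_rooted_perturb (F : rcfType) (r : seq F) (q : {poly F}) :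
  uniq r -> (size q <= size r)%N ->
  exists2 t, 0 < t & forall c, `|c| <= t -> exists s : seq F,
    \prod_(a <- r) ('X - a%:P) + c *: q = \prod_(a <- s) ('X - a%:P).
Proof.
move=> ur sq; set p := \prod_(a <- r) _.
(* Halving the gaps makes the intervals of radius [d] around distinct roots disjoint. *)
have [d d0 dmin] := finite_lower_bound [seq `|a - b| / 2 | a <- r, b <- r].
have dsep a b : a \in r -> b \in r -> b != a -> d < `|a - b| / 2.
  move=> ar br ba; apply: dmin; first by apply/allpairsP; exists (a, b).
  by rewrite divr_gt0 // normr_gt0 subr_eq0 eq_sym.
have psign a : a \in r -> p.[a - d] * p.[a + d] < 0.
  move=> ar; apply: prod_XsubC_sign_change => // b br ba.
  by have := dsep a b ar br ba; have := normr_ge0 (a - b); lra.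
pose ends := [seq a - d | a <- r] ++ [seq a + d | a <- r].
(* Below this [t], the perturbation at an endpoint is smaller than [p] there; the summand 1 keeps
   the denominators positive. *)
have [t t0 tmin] := finite_lower_bound
  [seq `|p.[e]| / (1 + `|q.[e]|) | e <- ends].
exists t => // c ct.
have small e : e \in ends -> p.[e] != 0 -> `|(c *: q).[e]| < `|p.[e]|.
  move=> ee pe0; rewrite hornerZ normrM.
  have q1 : 0 < 1 + `|q.[e]| by rewrite ltr_wpDr.
  have : t < `|p.[e]| / (1 + `|q.[e]|).
    apply: tmin; last by rewrite divr_gt0 // normr_gt0.
    exact: (map_f (fun x => `|p.[x]| / (1 + `|q.[x]|))).
  rewrite ltr_pdivlMr // => tp; apply: le_lt_trans tp.
  by apply: ler_pM => //; rewrite lerDr.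
(* The default root 0 outside [r] turns the choice of roots into a total function. *)
have ivt a : {x | a \in r -> `|x - a| < d /\ root (p + c *: q) x}.
  have [ar|nar] := boolP (a \in r); last by exists 0.
  have [||x] := @poly_ivtoo _ (p + c *: q) (a - d) (a + d).
  - by lra.
  - have := psign a ar; rewrite !(hornerD p) => pa.
    apply: perturbed_sign => //; apply: small.
    + by rewrite mem_cat (map_f (fun b => b - d)).
    + by apply: contraTneq pa => ->; rewrite mul0r ltxx.
    + by rewrite mem_cat (map_f (fun b => b + d)) ?orbT.
    + by apply: contraTneq pa => ->; rewrite mulr0 ltxx.
  rewrite in_itv /= => /andP[x1 x2] rx; exists x => _; split=> //.
  by rewrite ltr_norml; apply/andP; split; lra.
pose f a := sval (ivt a).
have fP a : a \in r -> `|f a - a| < d /\ root (p + c *: q) (f a).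
  by move=> ar; apply: (svalP (ivt a)).
have mp : p + c *: q \is monic.
  apply: monic_addr_lt; first exact: monic_prod_XsubC.
  by rewrite size_prod_XsubC ltnS (leq_trans (size_scale_leq _ _)).
exists (map f r); rewrite -[RHS]scale1r -(monicP mp).
apply: all_roots_prod_XsubC.
- rewrite size_map size_polyDl size_prod_XsubC //.
  by rewrite ltnS (leq_trans (size_scale_leq _ _)).
- by apply/allP => _ /mapP[a ar ->]; have [] := fP a ar.
rewrite uniq_rootsE map_inj_in_uniq // => a b ar br fab.
have [//|ba] := eqVneq b a; have := dsep a b ar br ba.
have [+ _] := fP a ar; have [+ _] := fP b br; rewrite fab.
rewrite !ltr_norml => /andP[? ?] /andP[? ?].
by have [] := ler0P (a - b); lra.
Qed.

(** * Symmetric multiaffine polynomials *)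

Lemma multiaffine_mesym1 n (m : 'X_{1..n}) : (forall i, (m i <= 1)%N) ->
  exists T : {set 'I_n}, m = mesym1 T.
Proof.
move=> m1; have : mechar (mdeg m) m by rewrite /mechar eqxx; apply/forallP.
by rewrite mecharP => /existsP[T /andP[/eqP-> _]]; exists T.
Qed.

(** The indicator tuples of the two sets contain [true] and [false] equally often, hence are
    rearrangements of each other. *)
Lemma mesym1_perm n (S T : {set 'I_n}) : #|S| = #|T| ->
  exists s : 'S_n, mesym1 S = [multinom mesym1 T (s i) | i < n].
Proof.
move=> ST; pose t (A : {set 'I_n}) := [tuple i \in A | i < n].
have countT (A : {set 'I_n}) : count_mem true (t A) = #|A|.
  rewrite /= count_map cardE -size_filter; congr size.
  by rewrite enumT; apply: eq_filter => i /=; rewrite eqb_id.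
have countF (A : {set 'I_n}) : (#|A| + count_mem false (t A) = n)%N.
  rewrite -countT -[RHS](size_tuple (t A)) -(count_predC (pred1 true)).
  by congr addn; apply: eq_count; case.
have /tuple_permP[s sE] : perm_eq (t S) (t T).
  apply/allP => -[] _ /=; apply/eqP; first by rewrite !countT ST.
  by apply: (@addnI #|S|); rewrite countF ST countF.
exists s; apply/mnmP => i; rewrite !mnmE; congr nat_of_bool.
have := congr1 (fun u : n.-tuple bool => tnth u i) (val_inj sE).
by rewrite !tnth_mktuple.
Qed.

(** Square-free monomials of equal degree are permuted transitively by the symmetric group, so
    symmetry forces their coefficients in [h] to agree. *)
Lemma symmetric_multiaffineE (K : nzRingType) n (h : {mpoly K[n]}) :
  h \is symmetric -> multiaffine h ->
  exists c : 'I_n.+1 -> K, h = \sum_j c j *: mesym n K j.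
Proof.
move=> hsym hma.
(* The coefficient is read off at any set of size [j]; since [j <= n] such a set exists and the
   default 0 never occurs. *)
exists (fun j : 'I_n.+1 => if [pick T : {set 'I_n} | #|T| == j :> nat] is Some T
                 then h@_(mesym1 T) else 0).
apply/mpolyP => m; rewrite raddf_sum /=.
have [/existsP[T /eqP mT]|nT] := boolP [exists T : {set 'I_n}, m == mesym1 T].
  have Tn : (#|T| < n.+1)%N by rewrite ltnS -[X in (_ <= X)%N]card_ord max_card.
  rewrite (bigD1 (Ordinal Tn)) //= big1 ?addr0 => [|j jT].
    rewrite mcoeffZ mcoeff_mesym mecharP.
    have -> : [exists S : {set 'I_n}, (m == mesym1 S) && (#|S| == #|T|)].
      by apply/existsP; exists T; rewrite mT !eqxx.
    rewrite mulr1; case: pickP => [S /eqP ST|/(_ T)]; last by rewrite eqxx.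
    have [s ->] := mesym1_perm ST; rewrite mT.
    by rewrite -mcoeff_sym (issymP _ hsym).
  rewrite mcoeffZ mcoeff_mesym mT /mechar mdeg_mesym1.
  rewrite (_ : (#|T| == j :> nat) = false) ?mulr0 //; apply: contraNF jT.
  by move=> /eqP Tj; apply/eqP/val_inj.
rewrite memN_msupp_eq0; last first.
  apply: contra nT => /hma/multiaffine_mesym1[T ->].
  by apply/existsP; exists T.
rewrite big1 // => j _; rewrite mcoeffZ mcoeff_mesym mecharP.
rewrite (_ : [exists _, _] = false) ?mulr0 //; apply: contraNF nT.
by move=> /existsP[T /andP[mT _]]; apply/existsP; exists T.
Qed.

(** Vieta's formulas; the signs are absorbed into [c]. The value thus becomes a linear functional of
    [root_poly y]. *)
Lemma symmetric_multiaffine_eval (K : idomainType) n (h : {mpoly K[n]}) :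
  h \is symmetric -> multiaffine h ->
  exists c : 'I_n.+1 -> K, forall y : 'I_n -> K,
    h.@[y] = \sum_j c j * (root_poly y)`_(n - j).
Proof.
move=> hsym hma; have [c hE] := symmetric_multiaffineE hsym hma.
exists (fun j => c j * (-1) ^+ j) => y.
rewrite hE raddf_sum /=; apply: eq_bigr => j _.
have -> : root_poly y = \prod_(w <- [tuple y i | i < n]) ('X - w%:P).
  by rewrite big_tuple; apply: eq_bigr => i _; rewrite tnth_mktuple.
rewrite mroots_coeff.
rewrite mevalZ -mulrA signrMK.
by congr (_ * _); apply: meval_eq => i; rewrite tnth_mktuple.
Qed.

(** * Energy maximisers in the upper half-plane *)

Section UpperHalfPlane.
Variables (R : realType).
Local Notation C := R[i].

(** Identifies the real space of dimension 2n with complex n-space, so that compactness of boxes of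
    real row vectors applies. *)
Definition coords n (u : 'rV[R]_(n + n)) (j : 'I_n) : C :=
  (u 0 (lshift n j) +i* u 0 (rshift n j))%C.

(** Stated through real and imaginary parts, which reduces continuity to that of real-valued
    maps. *)
Definition ccontinuous (T : topologicalType) (f : T -> C) :=
  continuous (fun u => complex.Re (f u) : R) /\
  continuous (fun u => complex.Im (f u) : R).

Lemma ccontinuousD (T : topologicalType) (f g : T -> C) :
  ccontinuous f -> ccontinuous g -> ccontinuous (fun u => f u + g u).
Proof.
move=> [fr fi] [gr gi]; split=> u.
  rewrite (_ : (fun _ => _) = (fun u => complex.Re (f u) + complex.Re (g u))).
    by apply: cvgD; [exact: fr | exact: gr].
  by apply/boolp.funext => v; rewrite raddfD.
rewrite (_ : (fun _ => _) = (fun u => complex.Im (f u) + complex.Im (g u))).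
  by apply: cvgD; [exact: fi | exact: gi].
by apply/boolp.funext => v; rewrite raddfD.
Qed.

Lemma ReM (a b : C) : complex.Re (a * b) =
  complex.Re a * complex.Re b - complex.Im a * complex.Im b.
Proof. by case: a b => ? ? [? ?]. Qed.

Lemma ImM (a b : C) : complex.Im (a * b) =
  complex.Re a * complex.Im b + complex.Im a * complex.Re b.
Proof. by case: a b => ? ? [? ?]. Qed.

Lemma ccontinuousM (T : topologicalType) (f g : T -> C) :
  ccontinuous f -> ccontinuous g -> ccontinuous (fun u => f u * g u).
Proof.
move=> [fr fi] [gr gi]; split=> u.
  rewrite (_ : (fun _ => _) = (fun u => complex.Re (f u) * complex.Re (g u)
    - complex.Im (f u) * complex.Im (g u))).
    by apply: cvgB; apply: cvgM; [exact: fr | exact: gr|exact: fi|exact: gi].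
  by apply/boolp.funext => v; rewrite ReM.
rewrite (_ : (fun _ => _) = (fun u => complex.Re (f u) * complex.Im (g u)
    + complex.Im (f u) * complex.Re (g u))).
  by apply: cvgD; apply: cvgM; [exact: fr | exact: gi|exact: fi|exact: gr].
by apply/boolp.funext => v; rewrite ImM.
Qed.

Lemma ccontinuous_cst (T : topologicalType) (c : C) : ccontinuous (fun _ : T => c).
Proof. by split=> u; exact: cvg_cst. Qed.

Lemma ccontinuous_sum (T : topologicalType) (I : Type) (s : seq I) (f : I -> T -> C) :
  (forall i, ccontinuous (f i)) -> ccontinuous (fun u => \sum_(i <- s) f i u).
Proof.
move=> cf; elim: s => [|i s IH].
  rewrite (_ : (fun _ => _) = fun=> 0); first exact: ccontinuous_cst.
  by apply/boolp.funext => v; rewrite big_nil.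
rewrite (_ : (fun _ => _) = fun u => f i u + \sum_(i <- s) f i u).
  exact: ccontinuousD.
by apply/boolp.funext => v; rewrite big_cons.
Qed.

Lemma ccontinuous_coef_prod (T : topologicalType) (I : Type) (s : seq I)
    (f : I -> T -> C) k :
  (forall i, ccontinuous (f i)) ->
  ccontinuous (fun u => (\prod_(i <- s) ('X - (f i u)%:P))`_k).
Proof.
move=> cf; elim: s k => [|i s IH] k.
  rewrite (_ : (fun _ => _) = fun=> (1 : {poly C})`_k); first exact: ccontinuous_cst.
  by apply/boolp.funext => v; rewrite big_nil.
(* Coefficient [k] of [('X - z) * q] is [q_(k-1) - z * q_k], where [q_(-1)] is 0. *)
rewrite (_ : (fun _ => _) = fun u =>
  (if k is k'.+1 then (\prod_(i <- s) ('X - (f i u)%:P))`_k' else 0)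
  + (-1) * (f i u * (\prod_(i <- s) ('X - (f i u)%:P))`_k)); last first.
  apply/boolp.funext => v; rewrite big_cons mulrBl coefB coefXM coefCM mulN1r.
  by case: k.
apply: ccontinuousD; first by case: k => [|k]; [exact: ccontinuous_cst | exact: IH].
by apply: ccontinuousM; [exact: ccontinuous_cst | apply: ccontinuousM].
Qed.

Lemma ccontinuous_coords n (j : 'I_n) :
  ccontinuous (fun u : 'rV[R]_(n + n) => coords u j).
Proof. by split=> u; exact: coord_continuous. Qed.

(** * Energy of a polynomial and its maximum on a compact fibre *)

Definition energy n (p : {poly C}) : R :=
  \sum_(j < n.+1) (complex.Re p`_j ^+ 2 + complex.Im p`_j ^+ 2).

Lemma ccontinuous_energy (T : topologicalType) n (p : T -> {poly C}) :
  (forall k, ccontinuous (fun u => (p u)`_k)) -> continuous (fun u => energy n (p u)).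
Proof.
move=> cp; rewrite /energy.
elim: {n}n.+1 => [|n IH].
  rewrite (_ : (fun _ => _) = fun=> 0); first by move=> u; exact: cvg_cst.
  by apply/boolp.funext => v; rewrite big_ord0.
under boolp.eq_fun do rewrite big_ord_recr /=.
have [cr ci] := cp n.
by move=> u; apply: cvgD; [exact: IH | apply: cvgD; rewrite expr2;
  apply: cvgM; [exact: cr|exact: cr|exact: ci|exact: ci]].
Qed.

Lemma norm_le_of_sqr_le (a T : R) : a ^+ 2 <= T -> `|a| <= 1 + T.
Proof. by move=> aT; rewrite ler_norml; apply/andP; split; nra. Qed.

(** The imaginary parts are nonnegative with sum [Im s1], which bounds each of them. The squares of
    the real parts sum to [Re s2] plus the sum of the squared imaginary parts, hence to at most
    [Re s2 + n (Im s1)^2]. *)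
Lemma upper_coord_bound n (z : 'I_n -> C) (j : 'I_n) (s1 s2 : C) :
  (forall i, 0 <= complex.Im (z i)) ->
  \sum_i z i = s1 -> \sum_i z i ^+ 2 = s2 ->
  `|complex.Im (z j)| <= complex.Im s1 /\
  `|complex.Re (z j)| <= 1 + (complex.Re s2 + complex.Im s1 ^+ 2 *+ n).
Proof.
move=> z0 <- <-; rewrite !raddf_sum /=.
have Imle i : complex.Im (z i) <= \sum_i complex.Im (z i).
  by rewrite (bigD1 i) //= lerDl sumr_ge0.
split; first by rewrite ger0_norm.
apply: norm_le_of_sqr_le.
apply: (@le_trans _ _ (\sum_i complex.Re (z i) ^+ 2)).
  by rewrite (bigD1 j) //= lerDl sumr_ge0 // => i _; exact: sqr_ge0.
rewrite -[X in _ *+ X]card_ord -sumr_const -big_split /=.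
apply: ler_sum => i _; rewrite [z i ^+ 2]expr2 ReM -!expr2 -addrA lerDl.
by rewrite addrC subr_ge0 ler_pXn2r ?nnegrE // sumr_ge0.
Qed.

Lemma linear_ccontinuous (T : topologicalType) n M
    (L : {linear {poly C} -> 'rV[C]_M}) (p : T -> {poly C}) i :
  (forall u, (size (p u) <= n)%N) -> (forall k, ccontinuous (fun u => (p u)`_k)) ->
  ccontinuous (fun u => L (p u) 0 i).
Proof.
move=> sp cp.
rewrite (_ : (fun _ => _) = fun u => \sum_(k < n) (p u)`_k * L ('X^k) 0 i).
  by apply: ccontinuous_sum => k; apply: ccontinuousM;
    [exact: cp | exact: ccontinuous_cst].
apply/boolp.funext => u.
have -> : p u = \sum_(k < n) (p u)`_k *: 'X^k.
  rewrite -poly_def; apply/polyP => k; rewrite coef_poly.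
  by case: ltnP => // nk; rewrite nth_default // (leq_trans (sp u)).
rewrite linear_sum summxE; apply: eq_bigr => k _.
by rewrite linearZ mxE -poly_def coef_poly ltn_ord.
Qed.

Lemma closed_real_le (T : topologicalType) (f : T -> R) (c : R) :
  continuous f -> closed [set u | c <= f u]%classic.
Proof.
move=> cf; rewrite (_ : [set u | _]%classic = f @^-1` [set y | c <= y])%classic //.
by apply: closed_comp => [u _|]; [exact: cf | exact: closed_ge].
Qed.

Lemma closed_real_eq (T : topologicalType) (f : T -> R) (c : R) :
  continuous f -> closed [set u | f u = c]%classic.
Proof.
move=> cf; rewrite (_ : [set u | _]%classic = f @^-1` [set y | y = c])%classic //.
by apply: closed_comp => [u _|]; [exact: cf | exact: closed_eq].
Qed.

(** Newton's identities: the two top nonleading coefficients determine the first two power sums of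
    the roots. *)
Lemma root_poly_sums n (x y : 'I_n -> C) :
  ('X * (root_poly y - root_poly x))`_n = 0 /\
    ('X ^+ 2 * (root_poly y - root_poly x))`_n = 0 ->
  \sum_i y i = \sum_i x i /\ \sum_i y i ^+ 2 = \sum_i x i ^+ 2.
Proof.
have top (z : 'I_n -> C) :
  ('X * root_poly z)`_n = - \sum_i z i /\
  ('X ^+ 2 * root_poly z)`_n *+ 2 = (\sum_i z i) ^+ 2 - \sum_i z i ^+ 2.
  have [_] := coef_prod_XsubC_top (map z (index_enum 'I_n)).
  have -> : size (map z (index_enum 'I_n)) = n.
    by rewrite size_map /index_enum -enumT size_enum_ord.
  by rewrite !big_map.
rewrite !mulrBr !coefB => -[/eqP + /eqP]; rewrite !subr_eq0.
have [y1 y2] := top y; have [x1 x2] := top x.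
rewrite y1 x1 eqr_opp => /eqP E1 /eqP E2; split=> //.
by move: y2; rewrite E1 E2 x2 => /addrI /oppr_inj.
Qed.

(** The hypothesis on [L] fixes both power sums along the fibre, which makes it bounded; it is
    closed and contains [x], so the extreme value theorem applies. *)
Lemma energy_max n M (L : {linear {poly C} -> 'rV[C]_M}) (x : 'I_n -> C) :
  (forall p, L p = 0 -> ('X * p)`_n = 0 /\ ('X ^+ 2 * p)`_n = 0) ->
  (forall j, 0 <= complex.Im (x j)) ->
  exists y : 'I_n -> C,
    [/\ forall j, 0 <= complex.Im (y j), L (root_poly y) = L (root_poly x) &
        forall z : 'I_n -> C, (forall j, 0 <= complex.Im (z j)) ->
          L (root_poly z) = L (root_poly x) ->
          energy n (root_poly z) <= energy n (root_poly y)].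
Proof.
move=> Ltop x0.
pose K := [set u : 'rV[R]_(n + n) | (forall j, 0 <= complex.Im (coords u j)) /\
   L (root_poly (@coords n u)) = L (root_poly x)]%classic.
have vecK z : exists u : 'rV[R]_(n + n), coords u = z.
  exists (row_mx (\row_j complex.Re (z j)) (\row_j complex.Im (z j))).
  apply/boolp.funext => j; rewrite /coords row_mxEl row_mxEr !mxE.
  by case: (z j).
have cp k : ccontinuous (fun u : 'rV[R]_(n + n) => (root_poly (@coords n u))`_k).
  by apply: ccontinuous_coef_prod => j; exact: ccontinuous_coords.
have cL i : ccontinuous (fun u : 'rV[R]_(n + n) => L (root_poly (@coords n u)) 0 i).
  by apply: (@linear_ccontinuous _ n.+1) => // u; rewrite size_root_poly.
have [u [u0 uL] umax] : exists2 u, K u &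
    forall v, K v -> energy n (root_poly (@coords n v)) <=
      energy n (root_poly (@coords n u)).
  have K0 : (K !=set0)%classic by have [u ux] := vecK x; exists u; split; rewrite ux.
  have cK : compact K.
    pose s1 := \sum_i x i; pose s2 := \sum_i x i ^+ 2.
    (* Adding the bounds for imaginary and real parts gives one radius valid for all 2n
       coordinates. *)
    pose b := complex.Im s1 + (1 + (complex.Re s2 + complex.Im s1 ^+ 2 *+ n)).
    have Kb : (K `<=` [set u : 'rV[R]_(n + n) |
        forall i, `[- b, b]%classic (u 0 i)])%classic.
      move=> u [u0 uL] i.
      have [E1 E2] : \sum_i coords u i = s1 /\ \sum_i coords u i ^+ 2 = s2.
        by apply: root_poly_sums => //; apply: Ltop; rewrite linearB uL subrr.
      suff : `|u 0 i| <= b by rewrite ler_norml /= in_itv.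
      have B j := upper_coord_bound j u0 E1 E2.
      rewrite -(splitK i); case: (split i) => j; have [Ij Rj] := B j.
        by rewrite (le_trans Rj) // lerDr (le_trans _ Ij).
      by rewrite (le_trans Ij) // lerDl (le_trans _ Rj).
    apply: subclosed_compact Kb; last first.
      by apply: (@rV_compact _ _ (fun=> `[- b, b]%classic)) => i;
        exact: segment_compact.
    (* Closedness of [K]: it is cut out by weak inequalities and equations between continuous real
       functions. *)
    rewrite (_ : K = (\bigcap_j [set u : 'rV[R]_(n + n) | 0%R <= complex.Im (coords u j)]
      `&` \bigcap_i ([set u | complex.Re (L (root_poly (@coords n u)) 0 i)
                       = complex.Re (L (root_poly x) 0 i)]
                `&` [set u | complex.Im (L (root_poly (@coords n u)) 0 i)
                       = complex.Im (L (root_poly x) 0 i)]))%classic).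
      apply: closedI; apply: closed_bigI => i _.
        by apply: closed_real_le; case: (ccontinuous_coords i).
      by case: (cL i) => cr ci; apply: closedI; exact: closed_real_eq.
    apply/seteqP; split=> u.
      by move=> [u0 uL]; split=> [j _ | i _]; [exact: u0 | split; rewrite /= uL].
    move=> [u0 uL]; split=> [j | ]; first exact: u0.
    apply/rowP => i; have [] := uL i I; rewrite /=.
    by move: (_ 0 i) (_ 0 i) => [? ?] [? ?] /= -> ->.
  have [|u uK umax] := @compact_EVT_max _ R
    (fun u => energy n (root_poly (@coords n u))) K K0 cK.
    exact/continuous_subspaceT/ccontinuous_energy.
  exists u => [|v vK]; first by move: uK; rewrite inE.
  by apply: umax; rewrite inE.
exists (coords u); split; [exact: u0 | exact: uL | move=> z z0 zL].
have [v vz] := vecK z; rewrite -vz; apply: umax; split; rewrite vz.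
  exact: z0.
exact: zL.
Qed.

(** * Strict convexity and extremality *)

Lemma energy_parallelogram n (p g : {poly C}) :
  energy n (p + g) + energy n (p - g) = (energy n p + energy n g) *+ 2.
Proof.
rewrite /energy -!big_split -sumrMnl; apply: eq_bigr => j _ /=.
rewrite coefD coefB !raddfD !raddfN /=; ring.
Qed.

Lemma energy_le0 n (g : {poly C}) :
  (size g <= n.+1)%N -> energy n g <= 0 -> g = 0.
Proof.
move=> sg g0; apply/polyP => j; rewrite coef0.
have [jn|nj] := ltnP j n.+1; last by rewrite nth_default // (leq_trans sg).
move: g0; rewrite /energy (bigD1 (Ordinal jn)) //=.
have : 0 <= \sum_(i < n.+1 | i != Ordinal jn)
    (complex.Re g`_i ^+ 2 + complex.Im g`_i ^+ 2).
  by apply: sumr_ge0 => i _; rewrite addr_ge0 // sqr_ge0.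
case: (g`_j) => a b /= s0 abs; have [a0 b0] : a = 0 /\ b = 0 by split; nra.
by rewrite a0 b0.
Qed.

Definition energy_maximal n M (L : {poly C} -> 'rV[C]_M) (y : 'I_n -> C) :=
  forall z : 'I_n -> C, (forall j, 0 <= complex.Im (z j)) ->
    L (root_poly z) = L (root_poly y) ->
    energy n (root_poly z) <= energy n (root_poly y).

(** Both [root_poly y + g] and [root_poly y - g] come from competitors of [y], so neither has larger
    energy; the parallelogram law then forces [energy n g <= 0]. *)
Lemma energy_maximal_extreme n M (L : {linear {poly C} -> 'rV[C]_M})
    (y : 'I_n -> C) (g : {poly C}) :
  energy_maximal L y -> (size g <= n)%N -> L g = 0 ->
  (forall z, root (root_poly y + g) z -> 0 <= complex.Im z) ->
  (forall z, root (root_poly y - g) z -> 0 <= complex.Im z) ->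
  g = 0.
Proof.
move=> ymax sg Lg rp rm; apply: (@energy_le0 n); first exact: leqW.
have le (h : {poly C}) : (size h <= n)%N -> L h = 0 ->
    (forall z, root (root_poly y + h) z -> 0 <= complex.Im z) ->
    energy n (root_poly y + h) <= energy n (root_poly y).
  move=> sh Lh rh; have [||z zE] := @closed_field_root_poly _ n (root_poly y + h).
  - by apply: monic_addr_lt; rewrite ?root_poly_monic ?size_root_poly.
  - by rewrite size_polyDl ?size_root_poly.
  rewrite zE; apply: ymax => [j|]; last by rewrite -zE linearD Lh addr0.
  by apply: rh; rewrite zE root_polyP; apply/existsP; exists j.
have := energy_parallelogram n (root_poly y) g.
have := le g sg Lg rp; have := le (- g); rewrite size_polyN linearN Lg oppr0.
move=> /(_ sg erefl rm); lra.
Qed.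

(** * Counting interior and boundary roots of a maximiser *)

(** On the open lower half-plane the product [p] satisfies [|q| <= B |p|]. For [|c| <= 1 / (2 B)], a
    root [z] of [p + c q] there would give [|p(z)| <= |p(z)| / 2] with [p(z)] nonzero. *)
Lemma prod_int_perturb (s : seq C) (q : {poly C}) :
  (forall w, w \in s -> 0 < complex.Im w) -> (size q <= size s)%N ->
  exists2 t : C, t != 0 & forall c z, `|c| <= `|t| ->
    root (\prod_(w <- s) ('X - w%:P) + c *: q) z -> 0 <= complex.Im z.
Proof.
move=> s0 sq; pose S (z : C) := complex.Im z < 0.
have Imle (z : C) : (`|complex.Im z|)%:C%C <= `|z|.
  by rewrite normc_def lecR -sqrtr_sqr ler_wsqrtr // lerDr sqr_ge0.
have far w : w \in s -> exists2 d : C, 0 < d & forall z, S z -> d <= `|z - w|.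
  (* The distance from [w] to the lower half-plane is its imaginary part. *)
  move=> ws; exists (complex.Im w)%:C%C; first by rewrite ltcR s0.
  move=> z z0; apply: le_trans (Imle _); rewrite lecR raddfB /=.
  rewrite -normrN opprB (le_trans _ (ler_norm _)) // lerDl oppr_ge0 ltW //.
have [B B0 dom] := prod_XsubC_dominates far sq.
have t0 : 0 < (2 * B)^-1 by rewrite invr_gt0 mulr_gt0.
exists (2 * B)^-1 => [|c z]; first by rewrite gt_eqF.
rewrite (gtr0_norm t0) => cB rz; rewrite leNgt; apply/negP => z0.
have nz : (\prod_(w <- s) ('X - w%:P)).[z] != 0.
  have [B' _ /(_ z z0)] := prod_XsubC_away far.
  by apply: contraTneq => ->; rewrite normr0 mulr0 lt_geF.
move: rz; rewrite rootE hornerD hornerZ addr_eq0 => /eqP pz.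
have := dom z z0; move: nz pz; set a := _.[z] => nz pz ab.
have : `|a| <= (2 * B)^-1 * (B * `|a|) by rewrite {1}pz normrN normrM ler_pM.
rewrite invfM -mulrA mulKf ?gt_eqF // ler_pdivlMl // mulr_natl mulr2n gerDl.
by rewrite normr_le0 (negPf nz).
Qed.

(** More than [M] interior roots leave more than [M] free coefficients for [q], so some nonzero [q]
    satisfies [L (A * q) = 0]; moving by small multiples of [A * q] in both directions contradicts
    extremality. *)
Lemma maximal_card_int n M (L : {linear {poly C} -> 'rV[C]_M}) (y : 'I_n -> C) :
  (forall j, 0 <= complex.Im (y j)) -> energy_maximal L y ->
  (#|[set j | (0 < complex.Im (y j))%R]| <= M)%N.
Proof.
move=> y0 ymax; rewrite leqNgt; apply/negP => MB.
set B := [set j | _] in MB.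
(* The noninterior roots are collected in [A] and do not move. *)
pose A := \prod_(j | j \notin B) ('X - (y j)%:P).
pose s := [seq y j | j <- enum B].
have FE : root_poly y = A * \prod_(w <- s) ('X - w%:P).
  by rewrite /root_poly (bigID (mem B)) mulrC /s big_map big_enum.
have mA : A \is monic by apply: monic_prod => j _; exact: monicXsubC.
have A0 : A != 0 by exact: monic_neq0.
have lf : linear (fun q => L (A * q)).
  by move=> c u v; rewrite mulrDr -scalerAr linearP.
have [q q0 [sq Lq]] := poly_kernel lf MB.
have ss : size s = #|B| by rewrite size_map cardE.
have s0 w : w \in s -> 0 < complex.Im w.
  by move=> /mapP[j]; rewrite mem_enum inE => ? ->.
have [|t t0 small] := @prod_int_perturb s q s0; first by rewrite ss.
suff /eqP : A * (t *: q) = 0.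
  by rewrite mulf_eq0 scaler_eq0 (negPf A0) (negPf q0) (negPf t0).
have sF : (size (root_poly y) = n.+1) by exact: size_root_poly.
have roots c z : `|c| <= `|t| -> root (root_poly y + A * (c *: q)) z ->
    0 <= complex.Im z.
  move=> ct; rewrite FE -mulrDr rootM => /orP[rA|]; last exact: small.
  have : root (root_poly y) z by rewrite FE rootM rA.
  by rewrite root_polyP => /existsP[j /eqP->].
apply: (energy_maximal_extreme ymax).
- have [->|nz] := eqVneq (A * (t *: q)) 0; first by rewrite size_poly0.
  rewrite -ltnS -sF FE !size_mul ?scaler_eq0 ?negb_or ?t0 //; last first.
    exact: monic_neq0 (monic_prod_XsubC _ _ _).
  rewrite size_prod_XsubC ss size_scale //.
  by rewrite addnS /= prednK ?addn_gt0 ?lt0n ?size_poly_eq0 ?A0 // leq_add2l.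
- by rewrite -scalerAr linearZ /= Lq scaler0.
- by move=> z; exact: roots.
- by move=> z; rewrite -mulrN -scaleNr; apply: roots; rewrite normrN.
Qed.

(** Boundary roots tolerate only real perturbations, and only of a product of distinct real factors.
    Over the reals the [M] complex conditions count as [2 * M], whence the factor 2 and distinct
    values in place of multiplicities. *)
Lemma maximal_size_bd n M (L : {linear {poly C} -> 'rV[C]_M}) (y : 'I_n -> C) :
  (forall j, 0 <= complex.Im (y j)) -> energy_maximal L y ->
  (size (undup [seq z <- codom y | (complex.Im z == 0)%R]) <= 2 * M)%N.
Proof.
move=> y0 ymax; rewrite leqNgt mul2n -addnn; apply/negP => MB.
set T := undup _ in MB.
pose r := [seq complex.Re z | z <- T].
have Tr : T = [seq x%:C%C | x <- r].
  rewrite -map_comp -[LHS]map_id; apply/eq_in_map => z.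
  rewrite mem_undup mem_filter => /andP[+ _]; case: z => a b /= /eqP->.
  by [].
have ur : uniq r.
  rewrite map_inj_in_uniq ?undup_uniq // => z w.
  rewrite !mem_undup !mem_filter => /andP[+ _] /andP[+ _].
  by case: z w => [a b] [a' b'] /= /eqP-> /eqP-> ->.
have sr : size r = size T by rewrite size_map.
pose P := \prod_(a <- r) ('X - a%:P).
pose toC (p : {poly R}) : {poly C} := map_poly (real_complex R) p.
have toC_prod (s : seq R) :
    toC (\prod_(a <- s) ('X - a%:P)) = \prod_(a <- s) ('X - (a%:C%C)%:P).
  by rewrite /toC rmorph_prod; apply: eq_bigr => a _; rewrite /= map_polyXsubC.
(* [W] gathers the nonreal roots and the repeated copies of the real ones; these stay fixed. *)
have /dvdpP[W FE] : toC P %| root_poly y.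
  rewrite toC_prod -(big_map (fun a => a%:C%C) xpredT (fun z => 'X - z%:P)) -Tr.
  apply: uniq_roots_dvdp; last by rewrite uniq_rootsE undup_uniq.
  apply/allP => z; rewrite mem_undup mem_filter => /andP[_ /codomP[j ->]].
  by rewrite root_polyP; apply/existsP; exists j.
have F0 : root_poly y != 0 by rewrite monic_neq0 // root_poly_monic.
have W0 : W != 0 by apply: contraNneq F0 => W0; rewrite FE W0 mul0r.
pose f (q : {poly R}) : 'rV[R]_(M + M) :=
  row_mx (map_mx (@complex.Re R) (L (W * toC q)))
         (map_mx (@complex.Im R) (L (W * toC q))).
have lf : linear f.
  move=> c u v; rewrite /f /toC rmorphD /= map_polyZ mulrDr -scalerAr linearP.
  rewrite scale_row_mx add_row_mx; congr row_mx; apply/rowP => i; rewrite !mxE.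
    by rewrite raddfD; congr (_ + _); case: (L _ 0 i) => a b /=; ring.
  by rewrite raddfD; congr (_ + _); case: (L _ 0 i) => a b /=; ring.
have [q q0 [sq fq]] := poly_kernel lf MB.
have Lq : L (W * toC q) = 0.
  apply/rowP => i; rewrite mxE.
  have /rowP/(_ (lshift M i)) := fq; rewrite row_mxEl !mxE.
  have /rowP/(_ (rshift M i)) := fq; rewrite row_mxEr !mxE.
  by move: (L _ 0 i) => [a b] /= -> ->.
have [|t t0 small] := @real_rooted_perturb R r q ur; first by rewrite sr.
suff /eqP : W * toC (t *: q) = 0.
  by rewrite mulf_eq0 map_poly_eq0 scaler_eq0 (negPf W0) (negPf q0) gt_eqF.
have roots c z : `|c| <= t -> root (root_poly y + W * toC (c *: q)) z ->
    0 <= complex.Im z.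
  move=> ct; rewrite FE -mulrDr rootM => /orP[rW|].
    have : root (root_poly y) z by rewrite FE rootM rW.
    by rewrite root_polyP => /existsP[j /eqP->].
  have [s sE] := small c ct; rewrite -rmorphD /= sE -/(toC _) toC_prod.
  rewrite rootE horner_prod prodf_seq_eq0 => /hasP[a _] /=.
  by rewrite hornerXsubC subr_eq0 => /eqP->.
have tt : `|t| <= t by rewrite gtr0_norm.
apply: (energy_maximal_extreme ymax).
- have [->|nz] := eqVneq (W * toC (t *: q)) 0; first by rewrite size_poly0.
  have qt0 : t *: q != 0 by rewrite scaler_eq0 negb_or q0 gt_eqF.
  have P0 : P != 0 by rewrite monic_neq0 // monic_prod_XsubC.
  rewrite -ltnS -(size_root_poly y) FE !size_mul ?map_poly_eq0 //.
  rewrite !size_map_poly size_prod_XsubC size_scale ?gt_eqF // sr.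
  by rewrite addnS /= prednK ?addn_gt0 ?lt0n ?size_poly_eq0 ?W0 // leq_add2l.
- by rewrite /toC map_polyZ -scalerAr linearZ /= Lq scaler0.
- by move=> z; exact: roots.
- by move=> z; rewrite -mulrN -rmorphN -scaleNr; apply: roots; rewrite normrN.
Qed.

Lemma upper_half_plane_reduction n M (L : {linear {poly C} -> 'rV[C]_M})
    (x : 'I_n -> C) :
  (forall p, L p = 0 -> ('X * p)`_n = 0 /\ ('X ^+ 2 * p)`_n = 0) ->
  (forall j, 0 <= complex.Im (x j)) ->
  exists y : 'I_n -> C,
    [/\ forall j, 0 <= complex.Im (y j), L (root_poly y) = L (root_poly x),
        (size (undup [seq z <- codom y | (complex.Im z == 0)%R]) <= 2 * M)%N &
        (#|[set j | (0 < complex.Im (y j))%R]| <= M)%N].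
Proof.
move=> Ltop x0; have [y [y0 yL ymax]] := energy_max Ltop x0.
have ymaxL : energy_maximal L y by move=> z z0; rewrite yL; exact: ymax.
by exists y; split; [exact: y0 | exact: yL | exact: maximal_size_bd ymaxL
  | exact: maximal_card_int ymaxL].
Qed.

(** * Affine change of variables *)

(** Substitution and scaling are linear, so coefficients after an affine change of the roots remain
    linear functionals of [root_poly y]. *)
Lemma root_poly_affine n (a b : C) (y : 'I_n -> C) : a != 0 ->
  root_poly (fun j => a * y j + b) =
  a ^+ n *: (root_poly y \Po (a^-1 *: ('X - b%:P))).
Proof.
move=> a0; have -> : a ^+ n = \prod_(j < n) a by rewrite prodr_const card_ord.
rewrite /root_poly rmorph_prod -scaler_prod.
apply: eq_bigr => j _ /=; rewrite comp_polyB comp_polyX comp_polyC.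
rewrite scalerBr scalerA divff // scale1r -mul_polyC -polyCM polyCD.
by rewrite opprD [RHS]addrAC addrA.
Qed.

Lemma symmetric_functionals n k (h : k.-tuple {mpoly C[n]}) (a b : C) :
  a != 0 ->
  (forall i : 'I_k, tnth h i \is symmetric /\ multiaffine (tnth h i)) ->
  exists L : {linear {poly C} -> 'rV[C]_(k + 2)},
    (forall p, L p = 0 -> ('X * p)`_n = 0 /\ ('X ^+ 2 * p)`_n = 0) /\
    (forall y z : 'I_n -> C, L (root_poly y) = L (root_poly z) ->
      forall i, (tnth h i).@[fun j => a * y j + b]
              = (tnth h i).@[fun j => a * z j + b]).
Proof.
move=> a0 hP.
have /boolp.choice[c cE] (i : 'I_k) : exists c : 'I_n.+1 -> C,
    forall y : 'I_n -> C,
    (tnth h i).@[y] = \sum_j c j * (root_poly y)`_(n - j).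
  by have [hs hm] := hP i; exact: symmetric_multiaffine_eval.
pose T (p : {poly C}) := a ^+ n *: (p \Po (a^-1 *: ('X - b%:P))).
(* The first [k] entries fix the values of [h] after the affine change; the last two, with exponents
   1 and 2, fix the top nonleading coefficients needed for compactness. *)
pose L0 (p : {poly C}) : 'rV[C]_(k + 2) :=
  row_mx (\row_i \sum_j c i j * (T p)`_(n - j))
         (\row_(i < 2) ('X ^+ i.+1 * p)`_n).
have linL0 : linear L0.
  move=> l u v; rewrite /L0 scale_row_mx add_row_mx; congr row_mx; apply/rowP => i.
    rewrite !mxE mulr_sumr -big_split; apply: eq_bigr => j _ /=.
    rewrite /T linearP scalerDr !scalerA ![_ * l]mulrC -!scalerA coefD coefZ.
    by rewrite mulrDr mulrCA.
  by rewrite !mxE mulrDr -scalerAr coefD coefZ.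
pose L : {linear {poly C} -> 'rV[C]_(k + 2)} :=
  HB.pack L0 (GRing.isLinear.Build _ _ _ _ L0 linL0).
exists L.
split=> [p /= /rowP Lp|y z /= /rowP Lyz i].
  have /= := Lp (rshift k 0); have /= := Lp (rshift k 1).
  by rewrite !row_mxEr !mxE.
rewrite !cE; have := Lyz (lshift 2 i).
by rewrite !row_mxEl !mxE /T -!root_poly_affine.
Qed.

End UpperHalfPlane.

Theorem theorem2p3 (R : realType) (n k : nat) (hk : (1 <= k)%N) (hkn : (k <= n)%N)
  (H : half_plane R) (f : {mpoly R[i][n]}) (fsym : f \is symmetric)
  (hf : exists (g : {mpoly R[i][k]}) (h : k.-tuple {mpoly R[i][n]}),
      (forall i : 'I_k, tnth h i \is symmetric /\ multiaffine (tnth h i)) /\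
      f = g \mPo h)
  (x : 'I_n -> R[i]) (hx : forall j : 'I_n, x j \in hp H) :
  exists xt : 'I_n -> R[i],
    xt \in hp_pq H (2 * (k + 2)) (k + 2) /\ f.@[x] = f.@[xt].
Proof.
have [g [h [hP ->]]] := hf.
have n0 := hp_normal_neq0 H.
have i0 : 'i%C != 0 :> R[i] by rewrite eq_complex /= oner_eq0 andbF.
(* With these constants [hp_normal H * (a * w + b) + hp_offset H] equals [- 'i * w], whose real part
   is [Im w]; the upper half-plane is carried onto [H]. *)
pose a := ('i%C * hp_normal H)^-1.
pose b := - (hp_offset H)%:C%C / hp_normal H.
have a0 : a != 0 by rewrite invr_neq0 // mulf_neq0.
have formE (w : R[i]) : hp_form H (a * w + b) = complex.Im w.
  rewrite /hp_form; have -> : hp_normal H * (a * w + b) =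
      - 'i%C * w - (hp_offset H)%:C%C.
    rewrite /a /b mulrDr; congr (_ + _); last by rewrite mulrC divfK.
    rewrite mulrA invfM [_^-1 * _]mulrC mulrA divff // mul1r; congr (_ * _).
    apply: (mulfI i0); rewrite divff // mulrN.
    by apply/eqP; rewrite eq_complex /=; apply/andP; split; apply/eqP; ring.
  by case: w => u v /=; ring.
pose y j := a^-1 * (x j - b).
have yx : (fun j => a * y j + b) = x.
  by apply/boolp.funext => j; rewrite /y mulVKf // subrK.
have [L [Ltop LE]] := symmetric_functionals b a0 hP.
have [|z [z0 Lz bdz intz]] := upper_half_plane_reduction (x := y) Ltop.
  by move=> j; rewrite -formE (congr1 (fun u => u j) yx); exact: hx.
exists (fun j => a * z j + b); split; last first.
  (* The value of [g \mPo h] depends on the point only through the values of [h]. *)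
  rewrite !comp_mpoly_meval; apply: meval_eq => i /=.
  by have := LE _ _ Lz i; rewrite yx => ->.
rewrite unfold_in; apply/and3P; split.
- by apply/forallP => j; rewrite unfold_in formE.
(* Injectivity of the affine map preserves the number of distinct boundary values. *)
- have ainj : injective (fun w => a * w + b) by move=> u v /addIr/(mulfI a0).
  rewrite codomE (map_comp (fun w => a * w + b) z) filter_map undup_map_inj //.
  rewrite size_map -codomE (eq_filter (a2 := fun w => complex.Im w == 0)) //.
  by move=> w /=; rewrite unfold_in formE.
- by under eq_finset do rewrite unfold_in formE.
Qed.
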